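(* Let $E_{p,q}$ be an Eschenburg manifold equipped with an Eschenburg metric, and let $h=|H^4(E_{p,q},\mathbb Z)|$. Then there exists an (almost free) isometric circle action on $E_{p,q}$ whose singular locus is composed of at most 3 points with the same parity if and only if $\alpha(\sigma,\epsilon_1,\epsilon_2)=0\in\mathbb Z/h$ for some choice of $\sigma\in S_3$ and $\epsilon_1,\epsilon_2\in\{1,-1\}$.
   Context: For $z\in\mathrm S^1=\{z\in\mathbb C:|z|=1\}$ and $p\in\mathbb Z^3$ put $z^p=\mathrm{diag}(z^{p_1},z^{p_2},z^{p_3})\in \mathrm U(3)$; for $q\in\mathbb Z^3$, $\sigma\in S_3$ put $q_\sigma=(q_{\sigma(1)},q_{\sigma(2)},q_{\sigma(3)})$. Let $p,q\in\mathbb Z^3$ with $\sum p_i=\sum q_i$. The circle acts on $\mathrm{SU}(3)$ by $z\cdot g=z^pg\,\bar z^{\,q}$; the action is free iff $\gcd(p_i-q_j,p_{i'}-q_{j'})=1$ for all $i\ne i'$, $j\neq j'$, and then the quotient $E_{p,q}$, with projection $\pi:\mathrm{SU}(3)\to E_{p,q}$, is called an Eschenburg manifold. One has $H^4(E_{p,q},\mathbb Z)\cong\mathbb Z_h$ with $h=|p_1p_2+p_1p_3+p_2p_3-q_1q_2-q_1q_3-q_2q_3|$ (an odd integer). An Eschenburg metric on $E_{p,q}$ is the submersion metric induced from the left-invariant (or, interchanging the two sides, right-invariant) metric on $\mathrm{SU}(3)$ obtained from a bi-invariant one by scaling it, by a constant factor in $(0,1)$, in the direction of $\mathrm U(2)_{jj}$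 for some $1\le j\le3$. Here $\mathrm U(2)_{ij}$ is the set of $g\in\mathrm{SU}(3)$ whose only nonzero entry in row $i$ and in column $j$ is the $(i,j)$ entry. Isometric circle actions on $E_{p,q}$: the isometric circle actions under consideration are those given by biquotient actions on $\mathrm{SU}(3)$ commuting with the defining one, i.e. the actions $\mathrm S^1_{a,b}$, $w\cdot[g]=[w^ag\,\bar w^{\,b}]$, with $a,b\in\mathbb Z^3$, $\sum a_i=\sum b_i$. If $\mathrm S^1_{a,b}$ is almost free (finite isotropy groups), let $\hat\pi:E_{p,q}\to O^{a,b}_{p,q}$ be the projection to the quotient orbifold. The singular locus of the action is the set of points of $O^{a,b}_{p,q}$ with nontrivial orbifold group, i.e. over which the isotropy group is strictly larger than the ineffective kernel of the action. For $\sigma\in S_3$ let $\mathrm T^2_\sigma$ be the set of $g\in\mathrm{SU}(3)$ whose nonzero entries are exactly those in positions $(i,\sigma(i))$, $i=1,2,3$, and $C_\sigma=\pi(\mathrm T^2_\sigma)$. The six points $\hat\pi(C_\sigma)\in O^{a,b}_{p,q}$ are called vertices, and the parity of the vertex $\hat\pi(C_\sigma)$ is the parity of $\sigma$. ''Composed of at most 3 points with the same parity'' means that the singular locus is contained in the set of the three vertices of one fixed parity (possibly empty). Definition of $\alpha$: for $\sigma\in S_3$ and $\epsilon_1,\epsilon_2=\pm1$, choose integers $x,y,z,w$ with $$x(p_1-q_{\sigma(2)})-y(p_2-q_{\sigma(3)})=\epsilon_1,\qquad w(p_1-q_{\sigma(3)})-z(p_2-q_{\sigma(1)})=\epsilon_2,$$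 and set $$\alpha(\sigma,\epsilon_1,\epsilon_2)=(x+y-z)(p_1-q_{\sigma(1)})-(w+z-x)(p_2-q_{\sigma(2)})+1 \ \bmod h,$$ which is independent of the choice of $x,y,z,w$. *)

(* Defs.v *)
(* The complex numbers are R[i] for an arbitrary R : realType. *)
From HB Require Import structures.
From mathcomp Require Import all_boot all_order all_fingroup all_algebra.
From mathcomp Require Import spectral.
From mathcomp Require Import all_classical reals.
From mathcomp Require Import complex.

Set Implicit Arguments.
Unset Strict Implicit.
Unset Printing Implicit Defensive.

Import Order.TTheory GRing.Theory Num.Theory.
Local Open Scope classical_set_scope.
Local Open Scope complex_scope.
Local Open Scope sesquilinear_scope.
Local Open Scope ring_scope.

(* The indices 1, 2, 3 of Z^3. *)
Definition i1 : 'I_3 := @Ordinal 3 0 isT.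
Definition i2 : 'I_3 := @Ordinal 3 1 isT.
Definition i3 : 'I_3 := @Ordinal 3 2 isT.

Section Biquotients.
Variable R : realType.
Local Notation C := R[i].
Local Notation M3 := 'M[C]_3.
Implicit Types (p q a b : 'I_3 -> int) (g k X Y : M3) (z w : C).

Definition S1 : set C := [set z | `|z| = 1].

Definition SU3 : set M3 := [set g | g \is unitarymx /\ \det g = 1].

Definition diagpow z p : M3 := diag_mx (\row_i z ^ p i).

Definition biq a b z g : M3 := diagpow z a *m g *m diagpow z^* b.

Definition free_action p q : Prop :=
  forall z g, S1 z -> SU3 g -> biq p q z g = g -> z = 1.

(* Points of E_{p,q} are the orbits of the action of S1 on SU(3), seen as
   subsets of SU(3). *)
Definition proj_E p q g : set M3 := [set biq p q z g | z in S1].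

Definition eschenburg_space p q : set (set M3) := proj_E p q @` SU3.

(* The action of S^1_{a,b} on E_{p,q}: it commutes with the defining action,
   so the image of the orbit of g under w is the orbit of w^a g wbar^b. *)
Definition act_E a b w (x : set M3) : set M3 := biq a b w @` x.

Definition isotropy a b (x : set M3) : set C :=
  [set w | S1 w /\ act_E a b w x = x].

Definition ineffective_kernel p q a b : set C :=
  [set w | S1 w /\ forall x, eschenburg_space p q x -> act_E a b w x = x].

Definition almost_free p q a b : Prop :=
  forall x, eschenburg_space p q x -> finite_set (isotropy a b x).

(* Points of the quotient orbifold are the S^1_{a,b}-orbits in E_{p,q}. *)
Definition proj_O a b (x : set M3) : set (set M3) := [set act_E a b w x | w in S1].

Definition singular_locus p q a b : set (set (set M3)) :=
  [set proj_O a b x | x in [set x | eschenburg_space p q x /\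
                                    ineffective_kernel p q a b `<` isotropy a b x]].

Definition T2 (s : 'S_3) : set M3 :=
  [set g | SU3 g /\ forall i j, (g i j != 0) = (j == s i)].

Definition Ccirc p q (s : 'S_3) : set (set M3) := proj_E p q @` T2 s.

(* When S^1_{a,b} is almost free it is transitive on each circle C_sigma, so the
   image of C_sigma below is a single point, the vertex of sigma. [e] is the
   parity ([true] for odd). *)
Definition vertices p q a b (e : bool) : set (set (set M3)) :=
  \bigcup_(s in [set s : 'S_3 | odd_perm s = e]) (proj_O a b @` Ccirc p q s).

(* Tangent spaces of SU(3) are realised inside the 3 x 3 complex matrices. *)
Definition su3 : set M3 := [set X | X ^t* = - X /\ \tr X = 0].

Definition tangent g : set M3 := [set X | su3 (g ^t* *m X)].

(* The Lie algebra of U(2)_{jj}. *)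
Definition u2 (j : 'I_3) : set M3 :=
  [set X | su3 X /\ forall i, i != j -> X i j = 0 /\ X j i = 0].

(* [m g X Y] is the inner product at g of tangent vectors X and Y; the values
   outside of g in SU(3) and X, Y tangent at g are irrelevant. *)
Definition metric : Type := M3 -> M3 -> M3 -> R.
Implicit Types m B : metric.

(* Smoothness in g is not required: this is only used for translation
   invariant metrics, for which it is automatic. *)
Definition riemannian m : Prop :=
  forall g, SU3 g ->
  [/\ forall X Y, tangent g X -> tangent g Y -> m g X Y = m g Y X,
      forall (r : R) X Y Z, tangent g X -> tangent g Y -> tangent g Z ->
        m g (r%:C *: X + Y) Z = r * m g X Z + m g Y Z
    & forall X, tangent g X -> X != 0 -> 0 < m g X X].

Definition left_invariant m : Prop :=
  forall k g X Y, SU3 k -> SU3 g -> tangent g X -> tangent g Y ->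
    m (k *m g) (k *m X) (k *m Y) = m g X Y.

Definition right_invariant m : Prop :=
  forall k g X Y, SU3 k -> SU3 g -> tangent g X -> tangent g Y ->
    m (g *m k) (X *m k) (Y *m k) = m g X Y.

Definition bi_invariant_metric m : Prop :=
  [/\ riemannian m, left_invariant m & right_invariant m].

Definition orth_u2 B (j : 'I_3) : set M3 :=
  [set X | su3 X /\ forall Y, u2 j Y -> B 1%:M X Y = 0].

Definition scaled_along_u2 B (j : 'I_3) (t : R) m : Prop :=
  forall X X' Y Y', u2 j X -> u2 j X' -> orth_u2 B j Y -> orth_u2 B j Y' ->
    m 1%:M (X + Y) (X' + Y') = t * B 1%:M X X' + B 1%:M Y Y'.

Definition eschenburg_metric_SU3 m : Prop :=
  (left_invariant m \/ right_invariant m) /\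
  exists (B : metric) (j : 'I_3) (t : R),
    [/\ bi_invariant_metric B, 0 < t, t < 1 & scaled_along_u2 B j t m].

(* Velocity at g of the curve theta |-> e^{i theta} . g, spanning the vertical
   line of SU(3) -> E_{p,q}. *)
Definition vertical p q g : M3 :=
  'i *: (diag_mx (\row_i (p i)%:~R) *m g - g *m diag_mx (\row_i (q i)%:~R)).

Definition horizontal_part m p q g X : M3 :=
  X - (m g X (vertical p q g) / m g (vertical p q g) (vertical p q g))%:C
        *: vertical p q g.

(* A metric on E_{p,q} is encoded by its pull-back to SU(3): the value at g on
   (X, Y) is the inner product at pi(g) of d pi(X) and d pi(Y). *)
Definition submersion_metric m p q : metric :=
  fun g X Y => m g (horizontal_part m p q g X) (horizontal_part m p q g Y).

Definition eschenburg_metric p q (mE : metric) : Prop :=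
  exists2 m, eschenburg_metric_SU3 m & mE = submersion_metric m p q.

(* [biq a b w] is the restriction of a linear map, hence is its own
   differential. *)
Definition isometric_action (mE : metric) a b : Prop :=
  forall w g X Y, S1 w -> SU3 g -> tangent g X -> tangent g Y ->
    mE (biq a b w g) (biq a b w X) (biq a b w Y) = mE g X Y.

End Biquotients.

Arguments free_action R p q : clear implicits.
Arguments almost_free R p q a b : clear implicits.
Arguments singular_locus R p q a b : clear implicits.
Arguments vertices R p q a b e : clear implicits.

(* Order of H^4(E_{p,q}, Z). *)
Definition order_H4 (p q : 'I_3 -> int) : int :=
  `|p i1 * p i2 + p i1 * p i3 + p i2 * p i3
    - q i1 * q i2 - q i1 * q i3 - q i2 * q i3|.

Definition alpha_eqs (p q : 'I_3 -> int) (s : 'S_3) (e1 e2 : int)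
    : set (int * int * int * int) :=
  [set u | let: (x, y, z, w) := u in
    x * (p i1 - q (s i2)) - y * (p i2 - q (s i3)) = e1 /\
    w * (p i1 - q (s i3)) - z * (p i2 - q (s i1)) = e2].

(* The class modulo h is represented by its remainder: 'Z_h would be wrong for
   h = 1. [xget] chooses a solution of the two equations; one exists when the
   action is free, and the class does not depend on it. *)
Definition alpha (p q : 'I_3 -> int) (s : 'S_3) (e1 e2 : int) : int :=
  let: (x, y, z, w) := xget (0, 0, 0, 0) (alpha_eqs p q s e1 e2) in
  (((x + y - z) * (p i1 - q (s i1)) - (w + z - x) * (p i2 - q (s i2)) + 1)
     %% order_H4 p q)%Z.

(* Main.v *)
Require Import Defs.
From mathcomp Require Import all_boot all_order all_fingroup all_algebra.
From mathcomp Require Import cyclic separable cyclotomic.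
From mathcomp Require Import all_classical reals.
From mathcomp Require Import spectral complex ring zify.

Set Implicit Arguments.
Unset Strict Implicit.
Unset Printing Implicit Defensive.

Import Order.TTheory GRing.Theory Num.Theory.
Local Open Scope classical_set_scope.
Local Open Scope sesquilinear_scope.
Local Open Scope ring_scope.

(** Together the two circles form a 2-torus: (z, w) multiplies the entry g_ij
by z ^ (p_i - q_j) * w ^ (a_i - b_j). So (z, w) fixes g when all the weights
at the nonzero entries of g take the value 1 at (z, w), and since the defining
action is free, the isotropy group of S^1_{a,b} at [g] is the stabiliser of g
in the torus. Over the vertex of s this stabiliser has order |D_s|, where D_s
is the determinant of the two weights at positions (1, s 1) and (2, s 2)
(the third weight is minus their sum); see [vertex_isotropyP]. Every g in SU(3)
has some transversal of nonzero entries, so the action is almost free when all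
six D_s are nonzero ([almost_freeP]).

Isometry is automatic: the metric on SU(3) is invariant under left and right
translations by diagonal matrices, because conjugation by them preserves both
summands of su(3) that the scaling distinguishes ([eschenburg_isometric]). Only the
singular locus is at stake.

If the vertices of one parity are all nonsingular, the stabiliser at each of
them is the common kernel, which means that the two weights at each such
vertex span the lattice L of all weights ([nonsingular_vertex]). Hence the three
D_s of that parity agree up to sign, and in coordinates adapted to L they
become 1 or -1. With x, y, z, w the second coordinates of the weights at
(2, s 3), (1, s 2), (1, s 3), (2, s 1), two of the three equations
D = 1 or D = -1 are the equations that define x, y, z, w in alpha, and the third
says that the representative of alpha(s, e1, e2) vanishes
([alpha_eq0_of_full_lattice]).

Conversely, the solutions (x, y) and (z, w) may be translated along their solution
lines, and this changes the representative of alpha by arbitrary multiples of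
the order h ([alpha_form_shift]); so if alpha is zero modulo h, some solution
makes it exactly zero, and x, y, z, w then give integers a and b for which
the three D of the parity of s are 1 or -1. A count modulo 2 shows that the
three other D are odd ([weight_det_F2]), so the action is almost free. A point
with nontrivial isotropy has no transversal of nonzero entries of the parity
of s; for a matrix in SU(3) this forces a single transversal of the opposite
parity and zeros elsewhere ([one_parity_support]), that is, a vertex. *)

(** * Permutations of three indices *)

Lemma ord3P (i : 'I_3) : [\/ i = i1, i = i2 | i = i3].
Proof.
case: i => [[|[|[|//]]]] h; [constructor 1|constructor 2|constructor 3];
  exact/val_inj.
Qed.

Lemma ord3_third {i k l m : 'I_3} : i != k -> i != l -> k != l ->
  [\/ m = i, m = k | m = l].
Proof.
case: (ord3P i) => ->; case: (ord3P k) => ->; case: (ord3P l) => -> //;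
  by case: (ord3P m) => ->; (by constructor 1) || (by constructor 2) || (by constructor 3).
Qed.

(** If two permutations agree at [i] and differ at [k], they exchange the values
at [k] and at the remaining index, so they differ by a transposition. *)
Lemma perm3_eq (s t : 'S_3) (i : 'I_3) :
  s i = t i -> odd_perm s = odd_perm t -> s = t.
Proof.
move=> sti st; apply/permP => k; apply: contra_eq st => stk.
have ik : i != k by apply: contra_neq stk => <-.
have [l il kl] : exists2 l, i != l & k != l.
  by move: ik; case: (ord3P i) => ->; case: (ord3P k) => -> // _;
    (by exists i1) || (by exists i2) || (by exists i3).
have inj (u : 'S_3) x y : x != y -> u x != u y by rewrite (inj_eq perm_inj).
have skl : s k = t l.
  case: (@ord3_third (t i) (t k) (t l) (s k) (inj _ _ _ ik) (inj _ _ _ il) (inj _ _ _ kl)) => //.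
    by rewrite -sti => /perm_inj e; rewrite e eqxx in ik.
  by move=> e; rewrite e eqxx in stk.
have slk : s l = t k.
  case: (@ord3_third (t i) (t k) (t l) (s l) (inj _ _ _ ik) (inj _ _ _ il) (inj _ _ _ kl)) => //.
    by rewrite -sti => /perm_inj e; rewrite e eqxx in il.
  by rewrite -skl => /perm_inj e; rewrite e eqxx in kl.
suff -> : t = (tperm k l * s)%g by rewrite odd_permM odd_tperm kl; case: odd_perm.
apply/permP => m; rewrite permM.
case: (ord3_third (m := m) ik il kl) => ->.
- by rewrite tpermD // eq_sym.
- by rewrite tpermL slk.
- by rewrite tpermR skl.
Qed.

(** The 3-cycle 1 -> 2 -> 3 -> 1; left multiplication by it relates the three
vertices of one parity, in the order in which [alpha] uses them. *)
Definition rot3 : 'S_3 := (tperm i1 i2 * tperm i1 i3)%g.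

Lemma odd_rot3 : odd_perm rot3 = false.
Proof. by rewrite odd_permM !odd_tperm. Qed.

Lemma rot3E : (rot3 i1 = i2) * (rot3 i2 = i3) * (rot3 i3 = i1).
Proof. by rewrite !permM !permE /=. Qed.

Lemma rot3M u :
  ((rot3 * u)%g i1 = u i2) * ((rot3 * u)%g i2 = u i3) * ((rot3 * u)%g i3 = u i1).
Proof. by rewrite !(permM rot3) !rot3E. Qed.

Lemma odd_rot3M u : odd_perm (rot3 * u)%g = odd_perm u.
Proof. by rewrite odd_permM odd_rot3. Qed.

Lemma perm3_coset (s t : 'S_3) : odd_perm s = odd_perm t ->
  [\/ t = s, t = (rot3 * s)%g | t = (rot3 * (rot3 * s))%g].
Proof.
move=> st.
have [k tk] : exists k, t i1 = s k.
  by exists ((s^-1)%g (t i1)); rewrite permKV.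
have := ord3P k; case=> hk; rewrite hk in tk.
- by constructor 1; apply/esym/(@perm3_eq _ _ i1).
- constructor 2; apply: (@perm3_eq _ _ i1); first by rewrite rot3M.
  by rewrite odd_rot3M.
- constructor 3; apply: (@perm3_eq _ _ i1); first by rewrite !rot3M.
  by rewrite !odd_rot3M.
Qed.

Lemma sum3 (V : nmodType) (F : 'I_3 -> V) : \sum_i F i = F i1 + F i2 + F i3.
Proof.
rewrite !big_ord_recl big_ord0 addr0 addrA; congr (F _ + F _ + F _); exact/val_inj.
Qed.

Lemma sum3_perm (V : nmodType) (F : 'I_3 -> V) (s : 'S_3) :
  F (s i1) + F (s i2) + F (s i3) = F i1 + F i2 + F i3.
Proof.
by rewrite -!sum3 -(sum3 (F \o s)) [RHS](reindex_inj (@perm_inj _ s)).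
Qed.

(** * Weights and their determinants *)

(** The circle with exponents [p], [q] multiplies the entry (i, j) of a matrix by
the power [weight p q i j] of the parameter. *)
Definition weight (p q : 'I_3 -> int) (i j : 'I_3) : int := p i - q j.

(** Rows 1 and 2 suffice because the weights along a transversal add up to zero:
any two rows give the same determinant up to sign. *)
Definition weight_det (P Q : 'I_3 -> 'I_3 -> int) (s : 'S_3) : int :=
  P i1 (s i1) * Q i2 (s i2) - P i2 (s i2) * Q i1 (s i1).

Lemma sum_weight_perm (p q : 'I_3 -> int) (s : 'S_3) :
  \sum_i p i = \sum_i q i ->
  weight p q i1 (s i1) + weight p q i2 (s i2) + weight p q i3 (s i3) = 0.
Proof.
rewrite !sum3 -(sum3_perm q s) /weight => pq.
by rewrite -[RHS](subrr (p i1 + p i2 + p i3)) {2}pq; ring.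
Qed.

Lemma weight_perm_third (p q : 'I_3 -> int) (s : 'S_3) i i' m :
  \sum_i p i = \sum_i q i -> i != i' ->
  exists u v, weight p q m (s m) = u * weight p q i (s i) + v * weight p q i' (s i').
Proof.
move=> pq; have S := sum_weight_perm s pq.
have [<- _|] := eqVneq m i; first by exists 1, 0; rewrite mul1r mul0r addr0.
have [<- _|] := eqVneq m i'; first by exists 0, 1; rewrite mul1r mul0r add0r.
move=> mi' mi ii'; exists (-1), (-1); move: mi' mi ii' S.
by case: (ord3P i) => ->; case: (ord3P i') => ->; case: (ord3P m) => -> //; lia.
Qed.

(** Here (P j, Q j) is the weight at (1, j) modulo 2, and (P j + c, Q j + d) the
one at (2, j). It is the difference of two points u_i and v_j of the affine plane
over F_2, and a determinant is 1 exactly when the three weights along the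
transversal are the three nonzero vectors. If this holds for the transversals of
one parity then no u_i equals any v_j. Both triples have the same sum, which
excludes that some u_i, but not all, coincide; so either all u_i coincide and
the v_j are the three other points, or the other way round, and in both cases
the transversals of the other parity also see all nonzero vectors. The proof
is an enumeration. *)
Lemma weight_det_F2 (P Q : 'I_3 -> 'F_2) (c d : 'F_2) :
  let D (j k : 'I_3) := P j * (Q k + d) - (P k + c) * Q j in
  D i1 i2 = 1 -> D i2 i3 = 1 -> D i3 i1 = 1 ->
  [/\ D i2 i1 = 1, D i3 i2 = 1 & D i1 i3 = 1].
Proof.
rewrite /=; move: (P i1) (P i2) (P i3) (Q i1) (Q i2) (Q i3) c d.
do 8 (case=> [[|[|//]] ?]); move=> /eqP A /eqP B /eqP C;
move: A B C => //= _ _ _; split; exact/eqP.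
Qed.

(** The second symmetric function is determined by the sum and the sum of
squares. *)
Lemma e2_perm (q : 'I_3 -> int) (s : 'S_3) :
  q (s i1) * q (s i2) + q (s i1) * q (s i3) + q (s i2) * q (s i3)
  = q i1 * q i2 + q i1 * q i3 + q i2 * q i3.
Proof.
have h1 := sum3_perm q s.
have h2 := sum3_perm (fun i => q i * q i) s.
have e (x y z : int) :
  2 * (x * y + x * z + y * z) = (x + y + z) * (x + y + z) - (x * x + y * y + z * z).
  by ring.
by apply: (@mulfI _ (2 : int)); rewrite // !e h1 h2.
Qed.

(** * Vanishing of alpha *)

(** The integer whose class modulo the order of H^4 is alpha - 1. *)
Definition alpha_form (p q : 'I_3 -> int) (s : 'S_3) (x y z w : int) : int :=
  (x + y - z) * (p i1 - q (s i1)) - (w + z - x) * (p i2 - q (s i2)).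

Definition signed_order_H4 (p q : 'I_3 -> int) : int :=
  p i1 * p i2 + p i1 * p i3 + p i2 * p i3
    - q i1 * q i2 - q i1 * q i3 - q i2 * q i3.

(** The general solution of each equation is a translate of a given one along
the line spanned by its two coefficients. Moving along these lines changes the
form by a multiple of the order of H^4. That makes the class of alpha well
defined, and conversely lets a class modulo h be adjusted to any of its integer
representatives. *)
Lemma alpha_form_shift (p q : 'I_3 -> int) (s : 'S_3) (x y z w m n : int) :
  \sum_i p i = \sum_i q i ->
  alpha_form p q s (x + m * (p i2 - q (s i3))) (y + m * (p i1 - q (s i2)))
    (z + n * (p i1 - q (s i3))) (w + n * (p i2 - q (s i1)))
  = alpha_form p q s x y z w - (m - n) * signed_order_H4 p q.
Proof.
rewrite !sum3 -(sum3_perm q s) => pq; rewrite /alpha_form /signed_order_H4.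
have e := e2_perm q s.
have -> : p i3 = q (s i1) + q (s i2) + q (s i3) - p i1 - p i2 by rewrite -pq; ring.
have -> : forall X : int, X - q i1 * q i2 - q i1 * q i3 - q i2 * q i3
  = X - (q i1 * q i2 + q i1 * q i3 + q i2 * q i3) by move=> X; ring.
rewrite -e; ring.
Qed.

Definition coprime_weights (p q : 'I_3 -> int) : Prop :=
  forall i i' j j', i != i' -> j != j' -> coprimez (p i - q j) (p i' - q j').

(** The parameter [m] is read off from a Bezout relation, without dividing by
[P] or [Q], one of which may vanish. *)
Lemma bezout_solution_shift (P Q e x y x' y' : int) : coprimez P Q ->
  x * P - y * Q = e -> x' * P - y' * Q = e ->
  exists m, x' = x + m * Q /\ y' = y + m * P.
Proof.
move=> /coprimezP[[u v] /= uv] xe xe'.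
have E : (x' - x) * P = (y' - y) * Q by move: xe; rewrite -xe'; lia.
exists (v * (x' - x) + u * (y' - y)); split; apply/eqP; rewrite -subr_eq0.
- have -> : x' - (x + (v * (x' - x) + u * (y' - y)) * Q) =
    (x' - x) * (1 - (u * P + v * Q)) + u * ((x' - x) * P - (y' - y) * Q) by ring.
  by rewrite uv E !subrr !mulr0 addr0.
- have -> : y' - (y + (v * (x' - x) + u * (y' - y)) * P) =
    (y' - y) * (1 - (u * P + v * Q)) - v * ((x' - x) * P - (y' - y) * Q) by ring.
  by rewrite uv E !subrr !mulr0 subr0.
Qed.

Section AlphaVanishing.
Variables (p q : 'I_3 -> int) (s : 'S_3).
Hypotheses (pq : \sum_i p i = \sum_i q i) (pq_coprime : coprime_weights p q).

Let cop1 : coprimez (p i1 - q (s i2)) (p i2 - q (s i3)).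
Proof. by apply: pq_coprime; rewrite ?(inj_eq perm_inj). Qed.

Let cop2 : coprimez (p i1 - q (s i3)) (p i2 - q (s i1)).
Proof. by apply: pq_coprime; rewrite ?(inj_eq perm_inj). Qed.

Lemma alpha_eqs_solvable e1 e2 : exists u, alpha_eqs p q s e1 e2 u.
Proof.
have /coprimezP[[u v] /= uv] := cop1; have /coprimezP[[u' v'] /= uv'] := cop2.
exists (e1 * u, - (e1 * v), - (e2 * v'), e2 * u'); split.
- by rewrite -[RHS]mulr1 -uv; ring.
- by rewrite -[RHS]mulr1 -uv'; ring.
Qed.

Lemma alpha_eq0P e1 e2 :
  alpha p q s e1 e2 = 0 <->
  exists x y z w, [/\ x * (p i1 - q (s i2)) - y * (p i2 - q (s i3)) = e1,
    w * (p i1 - q (s i3)) - z * (p i2 - q (s i1)) = e2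
    & alpha_form p q s x y z w = -1].
Proof.
rewrite /alpha; case: xgetP => [u _|no_sol]; last first.
  by have [u] := alpha_eqs_solvable e1 e2; move/(no_sol u).
case: u => [[[x y] z] w] [xy wz].
rewrite -/(alpha_form p q s x y z w) /order_H4 -/(signed_order_H4 p q).
split=> [/dvdz_mod0P|[x' [y' [z' [w' [xy' wz' form]]]]]].
- rewrite dvdzE absz_id -dvdzE => /dvdzP[c form].
  exists (x + c * (p i2 - q (s i3))), (y + c * (p i1 - q (s i2))), z, w.
  split=> //; first by rewrite -xy; ring.
  have := alpha_form_shift s x y z w c 0 pq.
  by rewrite !mul0r !addr0 => ->; lia.
- have [m [xE yE]] := bezout_solution_shift cop1 xy xy'.
  have [n [wE zE]] := bezout_solution_shift cop2 wz wz'.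
  apply/dvdz_mod0P; rewrite dvdzE absz_id -dvdzE.
  apply/dvdzP; exists (m - n).
  have := alpha_form_shift s x y z w m n pq.
  by rewrite -xE -yE -zE -wE form; lia.
Qed.

End AlphaVanishing.

(** * Matrices and unitarity *)

Section MatrixIdentities.
Variables (C : numClosedFieldType) (n : nat).
Implicit Types (A g k X V : 'M[C]_n) (P Q d e : 'rV[C]_n).

Lemma adjmxM (A B : 'M[C]_n) : (A *m B)^t* = B^t* *m A^t*.
Proof. by rewrite trmx_mul map_mxM. Qed.

(** Left translation back to the identity of a vector moved by a right
translation; the next identity is its mirror image. *)
Lemma adjmx_mulr g k X : (g *m k)^t* *m (X *m k) = k^t* *m (g^t* *m X) *m k.
Proof. by rewrite adjmxM !mulmxA. Qed.

Lemma mull_adjmx g k X : (k *m X) *m (k *m g)^t* = k *m (X *m g^t*) *m k^t*.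
Proof. by rewrite adjmxM !mulmxA. Qed.

(** Diagonal matrices commute, hence so do the infinitesimal circle action and the
translations by diagonal matrices. *)
Lemma diag_sandwich_comm (x : C) P Q d e g :
  let dge := diag_mx d *m g *m diag_mx e in
  x *: (diag_mx P *m dge - dge *m diag_mx Q) =
  diag_mx d *m (x *: (diag_mx P *m g - g *m diag_mx Q)) *m diag_mx e.
Proof.
rewrite /= -scalemxAr -scalemxAl mulmxBr mulmxBl; congr (_ *: (_ - _)).
- by rewrite !mulmxA [diag_mx P *m _]diag_mxC.
- by rewrite -!mulmxA [diag_mx e *m _]diag_mxC.
Qed.

Lemma sandwichB (x : C) k A X V :
  k *m X *m A - x *: (k *m V *m A) = k *m (X - x *: V) *m A.
Proof. by rewrite mulmxBr mulmxBl -scalemxAr -scalemxAl. Qed.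

Lemma sandwichDZ (x y : C) k A X V :
  k *m (x *: X + y *: V) *m A = x *: (k *m X *m A) + y *: (k *m V *m A).
Proof. by rewrite mulmxDr mulmxDl -!scalemxAr -!scalemxAl. Qed.

Lemma diag_sandwich_swap d e P Q X :
  diag_mx P *m (diag_mx d *m X *m diag_mx e) *m diag_mx Q =
  diag_mx d *m (diag_mx P *m X *m diag_mx Q) *m diag_mx e.
Proof.
rewrite -!mulmxA [diag_mx e *m _]diag_mxC !mulmxA; congr (_ *m _ *m _ *m _).
exact: diag_mxC.
Qed.

Lemma adj_diag_mx d : (diag_mx d)^t* = diag_mx (\row_i (d 0 i)^*).
Proof.
rewrite tr_diag_mx map_diag_mx; congr diag_mx; apply/rowP => i.
by rewrite !mxE.
Qed.

Lemma adj_int_diag (r : 'I_n -> int) :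
  (diag_mx (\row_i (r i)%:~R) : 'M[C]_n)^t* = diag_mx (\row_i (r i)%:~R).
Proof.
by rewrite adj_diag_mx; congr diag_mx; apply/rowP => i; rewrite !mxE rmorph_int.
Qed.

Lemma scale_unitarymx (c : C) g : `|c| = 1 -> g \is unitarymx -> c *: g \is unitarymx.
Proof.
move=> c1 ug; apply/unitarymxP; have -> : (c *: g)^t* = c^* *: g^t*.
  by apply/matrixP => i j; rewrite !mxE rmorphM.
rewrite -scalemxAl -scalemxAr scalerA -normCK c1 expr1n scale1r.
exact/unitarymxP.
Qed.

Lemma diag_sandwich_rescale (c : C) d e X : c != 0 ->
  diag_mx d *m X *m diag_mx e =
  diag_mx (c *: d) *m X *m diag_mx (c^-1 *: e).
Proof.
have dZ (x : C) f : diag_mx (x *: f) = x *: diag_mx f by exact: linearZ.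
move=> c0; rewrite !dZ -!scalemxAl -!scalemxAr scalerA.
by rewrite mulfV // scale1r.
Qed.

End MatrixIdentities.

(** The reflection in the plane orthogonal to (1, 1, 1). *)
Definition full_support (C : numClosedFieldType) : 'M[C]_3 :=
  1%:M - (2 / 3) *: const_mx 1.

Lemma full_support_neq0 (C : numClosedFieldType) i j : full_support C i j != 0.
Proof.
rewrite !mxE mulr1 subr_eq0; apply/negP => /eqP/(congr1 ( *%R^~ 3)).
rewrite divfK ?pnatr_eq0 // -natrM => /eqP; rewrite eqr_nat.
by case: (i == j).
Qed.

Lemma full_support_unitary (C : numClosedFieldType) : full_support C \is unitarymx.
Proof.
apply/unitarymxP; have -> : (full_support C)^t* = full_support C.
  apply/matrixP => i j; rewrite !mxE eq_sym rmorphB /= rmorph_nat mulr1.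
  by rewrite fmorph_div /= !rmorph_nat.
have J2 : (const_mx 1 : 'M_3) *m (const_mx 1 : 'M_3) = 3 *: const_mx 1 :> 'M[C]_3.
  by apply/matrixP => i j; rewrite !mxE sum3 !mxE; ring.
rewrite /full_support mulmxBl !mulmxBr mul1mx mulmx1 mul1mx.
rewrite -scalemxAl -scalemxAr J2 !scalerA; apply/matrixP => i j; rewrite !mxE.
by field.
Qed.

Lemma transversal_of_det_neq0 (C : fieldType) (g : 'M[C]_3) : \det g != 0 ->
  exists s : 'S_3, forall i, g i (s i) != 0.
Proof.
move=> dg; have /existsP[s /forallP gs] : [exists s : 'S_3, forall i, g i (s i) != 0].
  apply: contraNT dg => /existsPn no_s; apply/eqP; rewrite /determinant big1 // => s _.
  have [i /negPn/eqP gi] : exists i, ~~ (g i (s i) != 0).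
    by apply/existsP; rewrite -negb_forall no_s.
  by rewrite (bigD1 i) //= gi mul0r mulr0.
by exists s.
Qed.

Section Unitary.
Variable C : numClosedFieldType.
Implicit Types g : 'M[C]_3.

(** The inverse of g is both its adjugate and its adjoint, so the conjugate of an
entry is its cofactor; expand the cofactor. *)
Lemma normC2_transversals g i j : g \is unitarymx -> \det g = 1 ->
  `|g i j| ^+ 2 = \sum_(s : 'S_3 | s i == j) (-1) ^+ s * \prod_k g k (s k).
Proof.
move=> ug dg; have adjE : \adj g = g^t*.
  have := mul_mx_adj g; rewrite dg => /(congr1 (mulmx (g^t*))).
  by rewrite mulmxA (mulmx1C (unitarymxP ug)) mul1mx mulmx1.
have := congr1 (fun M : 'M_3 => M j i) adjE; rewrite !mxE => cof.
rewrite normCK -cof expand_cofactor big_distrr /=; apply: eq_bigr => s /eqP <-.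
rewrite mulrCA; congr (_ * _); rewrite [RHS](bigD1 i) //=; congr (_ * _).
by apply: eq_bigl => k; rewrite eq_sym.
Qed.

Lemma row_norm g i : g \is unitarymx -> \sum_j `|g i j| ^+ 2 = 1.
Proof.
move=> /unitarymxP/matrixP/(_ i i); rewrite !mxE eqxx => gi.
by rewrite -[RHS]gi; apply: eq_bigr => j _; rewrite !mxE normCK.
Qed.

(** For given i and j exactly one transversal of each parity passes through
(i, j). If those of one parity all contain a zero, the previous expansion of
|g_ij|^2 has the single term r of the other parity, and r is the same at the
three positions of that transversal. Taking the product of the three squared
moduli gives r^2 = r^3. So r is 0 or 1, and where it is 1 the unit rows of g
leave no room for a further nonzero entry. *)
Lemma one_parity_support g (e : bool) : g \is unitarymx -> \det g = 1 ->
  (forall s : 'S_3, odd_perm s = ~~ e -> \prod_i g i (s i) = 0) ->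
  exists2 s : 'S_3, odd_perm s = e & forall i j, (g i j != 0) = (j == s i).
Proof.
move=> ug dg no_transversal.
have [t gt] : exists t : 'S_3, forall i, g i (t i) != 0.
  by apply: transversal_of_det_neq0; rewrite dg oner_neq0.
have Pt : \prod_i g i (t i) != 0 by apply/prodf_neq0 => i _.
have te : odd_perm t = e.
  by apply: contraNeq Pt => te; apply/eqP/no_transversal; case: odd_perm te; case: (e).
pose r := (-1) ^+ t * \prod_i g i (t i).
have gr i : `|g i (t i)| ^+ 2 = r.
  rewrite normC2_transversals // (bigD1 t) //= [X in _ + X]big1 ?addr0 // => s /andP[/eqP si st].
  rewrite no_transversal ?mulr0 //; apply: contra_neq_eq st => se.
  by apply: perm3_eq si _; rewrite te; case: odd_perm se; case: (e).
have r_ge0 : 0 <= r by rewrite -(gr i1) exprn_ge0.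
have r_neq0 : r != 0 by rewrite mulf_neq0 ?signr_eq0.
have r23 : r ^+ 2 = r ^+ 3.
  have -> : r ^+ 2 = `|\prod_i g i (t i)| ^+ 2.
    by rewrite -(ger0_norm r_ge0) normrM normr_sign mul1r.
  by rewrite normr_prod -prodrXl (eq_bigr (fun=> r)) // big_const_ord iter_mulr_1.
have r1 : r = 1.
  by move: r23; rewrite (exprS _ 2) => /(congr1 ( *%R^~ (r ^- 2))); rewrite mulfK ?divff ?expf_neq0.
exists t => // i j; apply/idP/eqP => [gij|->]; last exact: gt.
apply: contraNeq gij => jti.
have := row_norm i ug; rewrite (bigD1 (t i)) //= gr r1 -[RHS]addr0 => /addrI S0.
have /eqP := S0; rewrite psumr_eq0 => [/allP/(_ j (mem_index_enum _))|k _]; last exact: exprn_ge0.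
by rewrite jti /= sqrf_eq0 normr_eq0.
Qed.

End Unitary.

(** * Unimodular numbers and the isotropy of the circle actions *)

Lemma prim_root_exists (C : numClosedFieldType) n :
  (n > 0)%N -> exists z : C, n.-primitive_root z.
Proof.
move=> n_gt0; have [r Dp] := closed_field_poly_normal ('X^n - 1 : {poly C}).
rewrite (monicP _) ?monicXnsubC // scale1r in Dp.
have rn1 : all n.-unity_root r by apply/allP=> z; rewrite -root_prod_XsubC -Dp.
have sz_r : (n < (size r).+1)%N.
  by rewrite -(size_prod_XsubC r id) -Dp size_XnsubC.
have [|z _ zn] := hasP (has_prim_root n_gt0 rn1 _ sz_r); last by exists z.
by rewrite -separable_prod_XsubC -Dp separable_Xn_sub_1 // pnatr_eq0 -lt0n.
Qed.

(** Eliminating [z] between two monomial equations, as in Cramer's rule. *)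
Lemma weight_det_unity (F : fieldType) (z w : F) (P Q : 'I_3 -> 'I_3 -> int) (s : 'S_3) :
  z != 0 -> w != 0 ->
  z ^ P i1 (s i1) * w ^ Q i1 (s i1) = 1 -> z ^ P i2 (s i2) * w ^ Q i2 (s i2) = 1 ->
  w ^ weight_det P Q s = 1.
Proof.
rewrite /weight_det => z0 w0.
set A := P i1 _; set B := P i2 _; set A' := Q i1 _; set B' := Q i2 _ => e1 e2.
have : (z ^ B * w ^ B') ^ A * ((z ^ A * w ^ A') ^ B)^-1 = 1.
  by rewrite e1 e2 !exp1rz invr1 mulr1.
rewrite !expfzMl !exprz_exp invfM !invr_expz mulrACA -!expfzDr // (mulrC B A).
by rewrite subrr expr0z mul1r (mulrC B' A) (mulrC A' B).
Qed.

Section Unimodular.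
Variable R : realType.
Local Notation C := R[i].
Implicit Types (p q a b : 'I_3 -> int) (g : 'M[C]_3) (z w : C).

Lemma S1_neq0 z : S1 z -> z != 0.
Proof. by rewrite /S1 /= => z1; rewrite -normr_eq0 z1 oner_eq0. Qed.

Lemma S1_conj z : S1 z -> z^* = z^-1.
Proof. by rewrite /S1 /= => z1; rewrite invC_norm z1 expr1n invr1 mul1r. Qed.

Lemma S1_1 : S1 (1 : C).
Proof. by rewrite /S1 /= normr1. Qed.

Lemma S1M z w : S1 z -> S1 w -> S1 (z * w).
Proof. by rewrite /S1 /= normrM => -> ->; rewrite mulr1. Qed.

Lemma S1V z : S1 z -> S1 z^-1.
Proof. by rewrite /S1 /= normfV => ->; rewrite invr1. Qed.

Lemma S1X z n : S1 z -> S1 (z ^+ n).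
Proof. by rewrite /S1 /= normrX => ->; rewrite expr1n. Qed.

Lemma S1Xz z (n : int) : S1 z -> S1 (z ^ n).
Proof. by case: n => n z1; [exact: S1X|exact/S1V/S1X]. Qed.

Lemma S1_root n z : (n > 0)%N -> S1 (z ^+ n) -> S1 z.
Proof.
rewrite /S1 /= normrX => n_gt0 /eqP; rewrite pexpr_eq1 //.
by move/eqP.
Qed.

Lemma S1_prim_root n (z : C) : n.-primitive_root z -> S1 z.
Proof.
move=> zn; apply: (@S1_root n); first exact: prim_order_gt0 zn.
by rewrite (prim_expr_order zn); apply: S1_1.
Qed.

Lemma prim_root_expz n (z : C) (k : int) : n.-primitive_root z ->
  (z ^ k == 1) = (n%:Z %| k)%Z.
Proof.
move=> zn; rewrite dvdzE /= (prim_order_dvd zn).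
by case: k => k //=; rewrite NegzE -invr_expz invr_eq1.
Qed.

Lemma finite_unity_roots (k : int) : k != 0 -> finite_set [set z : C | z ^ k = 1].
Proof.
move=> k_neq0; have n_gt0 : (0 < `|k|)%N by rewrite absz_gt0.
have [r Dp] := closed_field_poly_normal ('X^`|k|%N - 1 : {poly C}).
rewrite (monicP _) ?monicXnsubC // scale1r in Dp.
apply: sub_finite_set (finite_seq r) => z /= zk.
rewrite -root_prod_XsubC -Dp rootE !hornerE subr_eq0.
apply/eqP; move: zk; case: (k) => n //=.
by rewrite NegzE -invr_expz => /eqP; rewrite invr_eq1 => /eqP.
Qed.

Lemma biqE a b z g : S1 z ->
  biq a b z g = \matrix_(i, j) (z ^ weight a b i j * g i j).
Proof.
move=> z1; apply/matrixP => i j; rewrite /biq /diagpow mul_mx_diag mul_diag_mx.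
rewrite !mxE S1_conj // exprz_inv mulrAC -expfzDr //; exact: S1_neq0.
Qed.

Lemma biq1 a b g : biq a b 1 g = g.
Proof.
rewrite biqE; last exact: S1_1.
by apply/matrixP => i j; rewrite !mxE exp1rz mul1r.
Qed.

Lemma proj_E_refl p q g : proj_E p q g g.
Proof. by exists 1; [exact: S1_1|rewrite biq1]. Qed.

(** The isotropy of the second circle at [g] is the projection of the stabiliser
of [g] in the 2-torus. *)
Lemma isotropyP p q a b g w :
  isotropy a b (proj_E p q g) w <->
  S1 w /\ exists2 z, S1 z & forall i j, g i j != 0 ->
    z ^ weight p q i j * w ^ weight a b i j = 1.
Proof.
split=> [[w1 gw]|[w1 [z z1 zw]]]; split=> //.
- have : proj_E p q g (biq a b w g) by rewrite -gw; exists g => //; exact: proj_E_refl.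
  case=> z z1; rewrite !biqE // => /matrixP zg; exists z^-1; first exact: S1V.
  move=> i j gij; have := zg i j; rewrite !mxE => /(mulIf gij) <-.
  by rewrite exprz_inv -invr_expz mulVf // expfz_neq0 // S1_neq0.
- have zwE i j : g i j != 0 -> w ^ weight a b i j = z^-1 ^ weight p q i j.
    move=> gij; apply/(mulfI (expfz_neq0 (weight p q i j) (S1_neq0 z1))).
    by rewrite zw // exprz_inv -invr_expz mulfV // expfz_neq0 // S1_neq0.
  have eq_g i j (x y : C) : (g i j != 0 -> x = y) -> x * g i j = y * g i j.
    by case: (eqVneq (g i j) 0) => [->|_ -> //]; rewrite !mulr0.
  apply/seteqP; split=> [_ [_ [y y1 <-] <-]|_ [y y1 <-]].
  + exists (y * z^-1); first exact/S1M/S1V.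
    rewrite !biqE //; last exact/S1M/S1V.
    apply/matrixP => i j; rewrite !mxE mulrA; apply: eq_g => /zwE ->.
    by rewrite expfzMl mulrC.
  + exists (biq p q (y * z) g); first by exists (y * z) => //; exact: S1M.
    rewrite !biqE //; last exact/S1M.
    apply/matrixP => i j; rewrite !mxE mulrA; apply: eq_g => /zwE ->.
    by rewrite expfzMl exprz_inv -invr_expz mulrC mulfK // expfz_neq0 // S1_neq0.
Qed.

Lemma unitary_det_norm (M : 'M[C]_3) : M \is unitarymx -> S1 (\det M).
Proof.
move=> /unitarymxP/(congr1 determinant).
rewrite det_mulmx det1 det_map_mx det_tr -normCK => /eqP.
by rewrite sqrp_eq1 // => /eqP.
Qed.

(** Divide by a cube root of the determinant. *)
Lemma unitary_scale_SU3 (M : 'M[C]_3) : M \is unitarymx ->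
  exists c : C, [/\ S1 c, c ^+ 3 * \det M = 1 & SU3 (c *: M)].
Proof.
move=> uM; have dM := unitary_det_norm uM.
pose c := 3.-root (\det M)^-1.
have c3 : c ^+ 3 * \det M = 1 by rewrite rootCK // mulVf // S1_neq0.
have c1 : S1 c by apply: (@S1_root 3); rewrite // rootCK //; exact: S1V.
exists c; split; [exact: c1|exact: c3|split; last by rewrite detZ].
exact: scale_unitarymx.
Qed.

Lemma T2_nonempty (s : 'S_3) : exists g : 'M[C]_3, T2 s g.
Proof.
have [|c [c1 _ cSU]] := @unitary_scale_SU3 (perm_mx s).
  apply/unitarymxP; rewrite tr_perm_mx map_perm_mx -perm_mxM mulgV.
  exact: perm_mx1.
exists (c *: perm_mx s); split=> // i j.
by rewrite !mxE mulf_eq0 (negPf (S1_neq0 c1)) /= pnatr_eq0 eqb0 negbK eq_sym.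
Qed.

Lemma full_support_SU3 : exists2 g : 'M[C]_3, SU3 g & forall i j, g i j != 0.
Proof.
have [c [c1 _ cSU]] := unitary_scale_SU3 (full_support_unitary C).
exists (c *: full_support C) => // i j; rewrite mxE.
by apply: mulf_neq0; [exact: S1_neq0|exact: full_support_neq0].
Qed.

End Unimodular.

Section Actions.
Variable R : realType.
Local Notation C := R[i].
Variables p q : 'I_3 -> int.
Hypothesis pq : \sum_i p i = \sum_i q i.

Lemma biq_fix_T2 (z : C) (s : 'S_3) g : S1 z -> T2 s g ->
  (forall i, z ^ weight p q i (s i) = 1) -> biq p q z g = g.
Proof.
move=> z1 [_ gs] zs; rewrite biqE //; apply/matrixP => i j; rewrite mxE.
have := gs i j; have [->|_] := eqVneq j (s i); first by rewrite zs mul1r.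
by move/negbFE/eqP->; rewrite mulr0.
Qed.

(** A common divisor d of two weights in distinct rows and columns divides all
three weights of a transversal through these positions, so the d-th roots of
unity fix the corresponding vertex. *)
Lemma free_coprime_weights : free_action R p q -> coprime_weights p q.
Proof.
move=> free i i' j j' ii' jj'; apply: contraT => ncop.
set d := gcdz (p i - q j) (p i' - q j').
have [z z1 [z_neq1 zd]] : exists2 z : C, S1 z & z != 1 /\ forall k, (d %| k)%Z -> z ^ k = 1.
  have [d0|d_neq0] := eqVneq d 0.
    (* Both weights vanish: the whole circle fixes the vertex. *)
    exists (-1); first by rewrite /S1 /= normrN1.
    split; first by rewrite eq_sym -subr_eq0 opprK -(natrD _ 1 1) pnatr_eq0.
    by move=> k; rewrite d0 dvd0z => /eqP ->.
  have d_gt0 : (0 < `|d|)%N by rewrite absz_gt0.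
  have [z zn] := prim_root_exists C d_gt0.
  exists z; first exact: S1_prim_root zn.
  split; last by move=> k dk; apply/eqP; rewrite (prim_root_expz _ zn) dvdzE absz_id -dvdzE.
  rewrite -[z]expr1 -(prim_order_dvd zn) dvdn1.
  by move: ncop; rewrite /coprimez.
pose s := (tperm i j * tperm (tperm i j i') j')%g.
have si' : s i' = j' by rewrite permM tpermL.
have si : s i = j.
  rewrite permM tpermL tpermD // 1?eq_sym //.
  apply: contra_neq ii' => ji'; apply: (@perm_inj _ (tperm i j)).
  by rewrite tpermL.
have [g gs] := T2_nonempty R s.
case/eqP: z_neq1; apply: (free z g z1) => //; first by case: gs.
apply: (biq_fix_T2 z1 gs) => m; apply: zd.
have [u [v ->]] := weight_perm_third s m pq ii'.
rewrite si si'; apply: rpredD; apply: dvdz_mull; [exact: dvdz_gcdl|exact: dvdz_gcdr].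
Qed.

End Actions.

Section Isotropy.
Variable R : realType.
Local Notation C := R[i].
Variables p q a b : 'I_3 -> int.
Hypotheses (pq : \sum_i p i = \sum_i q i) (ab : \sum_i a i = \sum_i b i).
Hypothesis pq_coprime : coprime_weights p q.

Local Notation D := (weight_det (weight p q) (weight a b)).

(** The stabiliser of a vertex is cyclic, parametrised by the second circle:
it consists of the (w ^ k, w) with w ^ (D s) = 1. Here k solves the two
congruences k P + Q = 0 modulo D s, and a Bezout relation between the two
coprime weights of the free circle provides it. *)
Lemma stabilizer_exponent (s : 'S_3) :
  exists k, forall i, (D s %| k * weight p q i (s i) + weight a b i (s i))%Z.
Proof.
have /coprimezP[[r t] /= rt] : coprimez (weight p q i1 (s i1)) (weight p q i2 (s i2)).
  by apply: pq_coprime; rewrite ?(inj_eq perm_inj).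
have SP := sum_weight_perm s pq; have SQ := sum_weight_perm s ab.
rewrite /weight_det; move: rt SP SQ.
set A := weight p q i1 _; set B := weight p q i2 _.
set A' := weight a b i1 _; set B' := weight a b i2 _ => rt SP SQ.
exists (- (r * A' + t * B')).
have d1 : (A * B' - B * A' %| - (r * A' + t * B') * A + A')%Z.
  apply/dvdzP; exists (- t).
  by rewrite -[X in _ + X]mulr1 -rt; ring.
have d2 : (A * B' - B * A' %| - (r * A' + t * B') * B + B')%Z.
  apply/dvdzP; exists r.
  by rewrite -[X in _ + X]mulr1 -rt; ring.
move=> i; case: (ord3P i) => -> //.
have -> : weight p q i3 (s i3) = - (A + B) by lia.
have -> : weight a b i3 (s i3) = - (A' + B') by lia.
have kE (k : int) : k * - (A + B) + - (A' + B') = - ((k * A + A') + (k * B + B')) by ring.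
by rewrite kE rpredN rpredD.
Qed.

Lemma isotropy_weight_det (g : 'M[C]_3) (s : 'S_3) (w : C) :
  (forall i, g i (s i) != 0) -> isotropy a b (proj_E p q g) w -> w ^ D s = 1.
Proof.
move=> gs /isotropyP[w1 [z z1 zw]].
by apply: (weight_det_unity (S1_neq0 z1) (S1_neq0 w1)); rewrite zw.
Qed.

Lemma vertex_isotropyP (g : 'M[C]_3) (s : 'S_3) (w : C) : T2 s g ->
  isotropy a b (proj_E p q g) w <-> S1 w /\ w ^ D s = 1.
Proof.
move=> [_ gs]; split=> [gw|[w1 wD]].
  split; first by case: gw.
  by apply: isotropy_weight_det gw => i; rewrite gs.
have [k kP] := stabilizer_exponent s.
apply/isotropyP; split=> //; exists (w ^ k); first exact: S1Xz.
move=> i j; rewrite gs => /eqP ->.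
have /dvdzP[c cE] := kP i.
by rewrite exprz_exp -expfzDr ?S1_neq0 // cE mulrC -exprz_exp wD exp1rz.
Qed.

Lemma infinite_S1 : ~ finite_set (@S1 R).
Proof.
move=> /finite_seqP[r rE].
have [z zn] := prim_root_exists C (ltn0Sn (size r)).
have /uniq_leq_size : uniq [seq z ^+ i | i <- iota 0 (size r).+1].
  rewrite map_inj_in_uniq ?iota_uniq // => i j; rewrite !mem_iota /= !add0n => ir jr.
  by move=> /eqP; rewrite (eq_prim_root_expr zn) !modn_small // => /eqP.
move=> /(_ r); rewrite size_map size_iota ltnn.
have sub : {subset [seq z ^+ i | i <- iota 0 (size r).+1] <= r}.
  move=> _ /mapP[i _ ->]; have : S1 (z ^+ i) by apply/S1X/S1_prim_root/zn.
  by rewrite rE.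
by move=> /(_ sub).
Qed.

(** When [D s] vanishes the isotropy group at the vertex is the whole circle. *)
Lemma almost_freeP : almost_free R p q a b <-> forall s, D s != 0.
Proof.
split=> [fin s|D0 _ [g [_ dg] <-]].
  apply/eqP => Ds; have [g gs] := T2_nonempty R s.
  have /fin : eschenburg_space p q (proj_E p q g) by exists g => //; case: gs.
  apply: contra_not infinite_S1; apply: sub_finite_set => w w1.
  by apply/(vertex_isotropyP _ gs); rewrite Ds expr0z.
have [s gs] : exists s : 'S_3, forall i, g i (s i) != 0.
  by apply: transversal_of_det_neq0; rewrite dg oner_neq0.
by apply: sub_finite_set (finite_unity_roots R (D0 s)) => w /(isotropy_weight_det gs).
Qed.

(** The first circle element [z] that compensates [w] may depend on the point. A
point with no zero entry provides one that serves all positions at once. *)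
Lemma ineffective_kernel_unity (w : C) : ineffective_kernel p q a b w ->
  exists2 z, S1 z & forall i j, z ^ weight p q i j * w ^ weight a b i j = 1.
Proof.
move=> [w1 triv]; have [g gSU gfull] := full_support_SU3 R.
have /isotropyP[_ [z z1 zw]] : isotropy a b (proj_E p q g) w.
  by split=> //; apply: triv; exists g.
by exists z => // i j; apply: zw.
Qed.

(** Duality between subgroups of the torus and lattices of weights: if the
stabiliser of the vertex acts trivially, then every weight lies in the lattice
spanned by the weights of the vertex, which consists of the (P, Q) with
k P + Q divisible by [D s]. Evaluating at (w ^ k, w) for a primitive root of
unity w of order |D s| detects this divisibility. *)
Lemma nonsingular_vertex (g : 'M[C]_3) (s : 'S_3) : T2 s g -> D s != 0 ->
  isotropy a b (proj_E p q g) `<=` ineffective_kernel p q a b ->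
  exists k, forall i j, (D s %| k * weight p q i j + weight a b i j)%Z.
Proof.
move=> gs D0 trivial_isotropy.
have D_gt0 : (0 < `|D s|)%N by rewrite absz_gt0.
have [w wn] := prim_root_exists C D_gt0; have w1 := S1_prim_root wn.
have w_dvd k : (w ^ k == 1) = (D s %| k)%Z.
  by rewrite (prim_root_expz _ wn) dvdzE absz_id -dvdzE.
have wD : w ^ D s = 1 by apply/eqP; rewrite w_dvd.
have [z z1 zw] : exists2 z : C, S1 z &
    forall i j, z ^ weight p q i j * w ^ weight a b i j = 1.
  by apply/ineffective_kernel_unity/trivial_isotropy/(vertex_isotropyP _ gs).
have [k kP] := stabilizer_exponent s.
have w_pow i : w ^ (k * weight p q i (s i) + weight a b i (s i)) = 1.
  by apply/eqP; rewrite w_dvd.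
(* Both z and w ^ k compensate w at the vertex, where the first circle acts
   freely. *)
have zk : z / w ^ k = 1.
  have z_pow i : (z / w ^ k) ^ weight p q i (s i) = 1.
    have e : z ^ weight p q i (s i) = w ^ (k * weight p q i (s i)).
      apply/(mulIf (expfz_neq0 (weight a b i (s i)) (S1_neq0 w1))).
      by rewrite zw -expfzDr ?S1_neq0.
    by rewrite expfzMl exprz_inv -invr_expz exprz_exp e mulfV // expfz_neq0 // S1_neq0.
  have /coprimezP[[r t] /= rt] : coprimez (weight p q i1 (s i1)) (weight p q i2 (s i2)).
    by apply: pq_coprime; rewrite ?(inj_eq perm_inj).
  have zk0 : z / w ^ k != 0 by rewrite mulf_neq0 ?invr_neq0 ?expfz_neq0 ?S1_neq0.
  by rewrite -[LHS]expr1z -rt expfzDr // (mulrC r) (mulrC t) -!exprz_exp !z_pow !exp1rz mulr1.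
exists k => i j; rewrite -w_dvd expfzDr ?S1_neq0 // -exprz_exp.
have -> : w ^ k = z by rewrite -[RHS](divfK (expfz_neq0 k (S1_neq0 w1))) zk mul1r.
by rewrite zw.
Qed.

End Isotropy.

(** * Lattices of weights and alpha *)

(** The determinant does not change when multiples of [P] are added to [Q]. *)
Lemma weight_det_dvd (P Q : 'I_3 -> 'I_3 -> int) (d k : int) (t : 'S_3) :
  (forall i j, (d %| k * P i j + Q i j)%Z) -> (d %| weight_det P Q t)%Z.
Proof.
move=> dQ.
have -> : weight_det P Q t = P i1 (t i1) * (k * P i2 (t i2) + Q i2 (t i2))
    - P i2 (t i2) * (k * P i1 (t i1) + Q i1 (t i1)) by rewrite /weight_det; ring.
by apply: rpredB; apply: dvdz_mull.
Qed.

Section Arithmetic.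
Variables p q a b : 'I_3 -> int.
Hypotheses (pq : \sum_i p i = \sum_i q i).
Hypothesis pq_coprime : coprime_weights p q.
Local Notation D := (weight_det (weight p q) (weight a b)).

(** The hypothesis says that the weights at each of the three vertices span
the lattice of all weights. In coordinates adapted to that lattice the second
weights become [Q], and the three determinants become units. *)
Lemma alpha_eq0_of_full_lattice (s : 'S_3) :
  (forall t, odd_perm t = odd_perm s -> D t != 0 /\
    exists k, forall i j, (D t %| k * weight p q i j + weight a b i j)%Z) ->
  exists e1 e2, [/\ e1 = 1 \/ e1 = -1, e2 = 1 \/ e2 = -1 & alpha p q s e1 e2 = 0].
Proof.
move=> lat; have [D0 [k kP]] := lat s erefl.
(* The sign makes the determinant at s equal to -1, as the term + 1 in alpha
   requires. *)
pose Q i j := - ((k * weight p q i j + weight a b i j) %/ D s)%Z.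
have QE i j : D s * Q i j = - (k * weight p q i j + weight a b i j).
  by rewrite /Q mulrN mulrC divzK.
have DQ t : D t = D s * - weight_det (weight p q) Q t.
  have -> : D s * - weight_det (weight p q) Q t =
      weight p q i2 (t i2) * (D s * Q i1 (t i1)) - weight p q i1 (t i1) * (D s * Q i2 (t i2)).
    by rewrite {2}/weight_det; ring.
  by rewrite !QE /weight_det; ring.
(* D t and D s divide each other. *)
have Qunit t : odd_perm t = odd_perm s ->
    weight_det (weight p q) Q t = 1 \/ weight_det (weight p q) Q t = -1.
  move=> /lat[_ [l lP]]; have := weight_det_dvd s lP; rewrite (DQ t) -[X in (_ %| X)%Z]mulr1.
  rewrite dvdz_mul2l //= => /dvdzP[c].
  move=> /(congr1 absz); rewrite abszM abszN => /esym/eqP; rewrite muln_eq1 => /andP[_].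
  by lia.
have Qs : weight_det (weight p q) Q s = -1.
  by apply/(mulfI D0); rewrite mulrN1 -[X in - X]mulr1 {2}DQ; ring.
exists (weight_det (weight p q) Q (rot3 * s)), (weight_det (weight p q) Q (rot3 * (rot3 * s))).
split; [by apply: Qunit; rewrite odd_rot3M|by apply: Qunit; rewrite !odd_rot3M|].
apply/(alpha_eq0P _ pq pq_coprime).
have rect i j i' j' : Q i j + Q i' j' = Q i j' + Q i' j.
  by apply/(mulfI D0); rewrite !mulrDr !QE /weight; ring.
exists (Q i2 (s i3)), (Q i1 (s i2)), (Q i1 (s i3)), (Q i2 (s i1)).
rewrite -Qs /weight_det !rot3M /alpha_form /weight; split; [ring|ring|].
have -> : Q i2 (s i2) = Q i2 (s i3) + Q i1 (s i2) - Q i1 (s i3).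
  by apply/eqP; rewrite eq_sym subr_eq addrC rect addrC.
have -> : Q i1 (s i1) = Q i2 (s i1) + Q i1 (s i3) - Q i2 (s i3).
  by apply/eqP; rewrite eq_sym subr_eq addrC rect.
by ring.
Qed.

(** The three other determinants are odd. *)
Lemma weight_det_opposite_neq0 (s : 'S_3) :
  (forall t, odd_perm t = odd_perm s -> D t = 1 \/ D t = -1) ->
  forall t, odd_perm t != odd_perm s -> D t != 0.
Proof.
move=> Dunit t ts.
pose r (n : int) : 'F_2 := n%:~R.
pose P j := r (weight p q i1 (s j)); pose Q j := r (weight a b i1 (s j)).
pose c := r (p i2 - p i1); pose d := r (a i2 - a i1).
have rD (u : 'S_3) j k : u i1 = s j -> u i2 = s k -> r (D u) = P j * (Q k + d) - (P k + c) * Q j.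
  rewrite /weight_det => -> ->; rewrite /P /Q /c /d /r -!rmorphD -!rmorphM -rmorphB /=.
  by congr intmul; rewrite /weight; ring.
have r1 u : odd_perm u = odd_perm s -> r (D u) = 1.
  by move=> /Dunit[] ->; rewrite /r ?rmorphN1; apply/eqP.
have [w21 w32 w13] := @weight_det_F2 P Q c d
  (etrans (esym (rD s i1 i2 erefl erefl)) (r1 s erefl))
  (etrans (esym (rD _ i2 i3 (rot3M s).1.1 (rot3M s).1.2)) (r1 _ (odd_rot3M s)))
  (etrans (esym (rD _ i3 i1
    (etrans (rot3M _).1.1 (rot3M s).1.2) (etrans (rot3M _).1.2 (rot3M s).2)))
    (r1 _ (etrans (odd_rot3M _) (odd_rot3M s)))).
suff : r (D t) = 1 by apply: contra_eq_neq => ->; apply/eqP.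
have [t' tE] : exists t', t = (tperm i1 i2 * t')%g.
  by exists (tperm i1 i2 * t)%g; rewrite mulgA tperm2 mul1g.
have t1 : t i1 = t' i2 by rewrite tE permM tpermL.
have t2 : t i2 = t' i1 by rewrite tE permM tpermR.
have t's : odd_perm s = odd_perm t'.
  by move: ts; rewrite tE odd_permM odd_tperm /=; case: odd_perm; case: odd_perm.
case: (perm3_coset t's) => t'E; rewrite t'E ?rot3M in t1 t2.
- by rewrite (rD _ _ _ t1 t2).
- by rewrite (rD _ _ _ t1 t2).
- by rewrite (rD _ _ _ t1 t2).
Qed.

End Arithmetic.

(** * Eschenburg metrics are invariant under diagonal translations *)

Section Metric.
Variable R : realType.
Local Notation C := R[i].
Local Notation M3 := 'M[C]_3.
Implicit Types (p q a b : 'I_3 -> int) (g k X Y : M3) (m B : metric R).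

Lemma SU3_adjV k : SU3 k -> k *m k^t* = 1%:M.
Proof. by move=> [/unitarymxP]. Qed.

Lemma SU3_adjK k : SU3 k -> k^t* *m k = 1%:M.
Proof. by move=> [/unitarymxP/mulmx1C]. Qed.

Lemma SU3M k g : SU3 k -> SU3 g -> SU3 (k *m g).
Proof.
move=> [uk dk] [ug dg]; split; first exact: mul_unitarymx.
by rewrite det_mulmx dk dg mulr1.
Qed.

Lemma SU3_adj k : SU3 k -> SU3 (k^t*).
Proof.
move=> kS; have [uk dk] := kS; split; first by rewrite trmxC_unitary.
by rewrite -[LHS]mul1r -{1}dk -det_mulmx SU3_adjV // det1.
Qed.

Lemma SU3_1 : SU3 (1%:M : M3).
Proof.
split; last exact: det1.
by apply/unitarymxP; rewrite trmx1 map_mx1 mulmx1.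
Qed.

Lemma su3_Ad k X : SU3 k -> su3 X -> su3 (k *m X *m k^t*).
Proof.
move=> kS [aX tX]; split.
  by rewrite !adjmxM trmxCK aX mulNmx mulmxN mulmxA.
by rewrite mxtrace_mulC mulmxA SU3_adjK // mul1mx.
Qed.

Lemma su3_lin (r : R) X Y : su3 X -> su3 Y -> su3 (r%:C%C *: X + Y).
Proof.
move=> [aX tX] [aY tY]; split; last by rewrite mxtraceD mxtraceZ tX tY mulr0 addr0.
apply/matrixP => i j.
have := congr1 (fun M : M3 => M i j) aX; have := congr1 (fun M : M3 => M i j) aY.
rewrite !mxE => eY eX; rewrite rmorphD rmorphM /= eX eY opprD mulrN.
by congr (- (_ * _) - _); apply/CrealP/complex_realP; exists r.
Qed.

Lemma tangent1 X : tangent 1%:M X <-> su3 X.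
Proof. by rewrite /tangent /= trmx1 map_mx1 mul1mx. Qed.

Lemma tangent_lin g (r : R) X Y :
  tangent g X -> tangent g Y -> tangent g (r%:C%C *: X + Y).
Proof.
by rewrite /tangent /= mulmxDr -scalemxAr; apply: su3_lin.
Qed.

Lemma tangent_mull k g X : SU3 k -> tangent g X -> tangent (k *m g) (k *m X).
Proof.
by move=> kS; rewrite /tangent /= adjmxM -mulmxA (mulmxA _ k) SU3_adjK // mul1mx.
Qed.

Lemma tangent_mulr k g X : SU3 k -> tangent g X -> tangent (g *m k) (X *m k).
Proof.
move=> kS; rewrite /tangent /= adjmxM => /(su3_Ad (SU3_adj kS)).
by rewrite trmxCK !mulmxA.
Qed.

Lemma tangent_su3r g X : SU3 g -> tangent g X -> su3 (X *m g^t*).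
Proof.
move=> gS /(su3_Ad gS); rewrite !mulmxA SU3_adjV // mul1mx //.
Qed.

Lemma bi_invariant_Ad B k X Y : bi_invariant_metric B -> SU3 k -> su3 X -> su3 Y ->
  B 1%:M (k *m X *m k^t*) (k *m Y *m k^t*) = B 1%:M X Y.
Proof.
move=> [_ Bl Br] kS /tangent1 tX /tangent1 tY.
have tl Z : tangent 1%:M Z -> tangent k (k *m Z).
  by rewrite -{1}[k]mulmx1; apply: tangent_mull.
rewrite -{1}(SU3_adjV kS) (Br _ _ _ _ (SU3_adj kS) kS (tl _ tX) (tl _ tY)).
by rewrite -{1}[k]mulmx1 (Bl _ _ _ _ kS SU3_1 tX tY).
Qed.

(** Linearity is only available in the form r X + Y; -X is (-2) X + X. *)
Lemma riemannian_opp B X Y : riemannian B -> su3 X -> su3 Y ->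
  B 1%:M (- X) Y = - B 1%:M X Y.
Proof.
move=> /(_ _ SU3_1)[_ Blin _] /tangent1 tX /tangent1 tY.
have := Blin (-2) X X Y tX tX tY.
have -> : (-2 : R)%:C%C *: X + X = - X.
  by rewrite rmorphN /= rmorph_nat scaleNr scaler_nat mulr2n opprD addrNK.
by move=> ->; ring.
Qed.

(** Conjugation by this involution is the identity on the Lie algebra of U(2)_jj
and -1 on the matrices of su(3) whose nonzero entries lie in row j or column j,
off the diagonal. Being an isometry of a bi-invariant
metric, it exhibits these matrices as the orthogonal complement, whatever the
bi-invariant metric. *)
Definition refl (j : 'I_3) : M3 := diag_mx (\row_i (if i == j then 1 else -1)).

Lemma refl_adj j : (refl j)^t* = refl j.
Proof.
rewrite adj_diag_mx; congr diag_mx; apply/rowP => i.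
by rewrite !mxE; case: ifP; rewrite ?rmorphN1 ?rmorph1.
Qed.

Lemma refl_SU3 j : SU3 (refl j).
Proof.
split; last first.
  rewrite det_diag (bigD1 j) //= mxE eqxx mul1r (eq_bigr (fun=> -1)) => [|i /negPf ij].
    by rewrite prodr_const (cardC1 j) card_ord -signr_odd expr0.
  by rewrite mxE ij.
apply/unitarymxP; rewrite refl_adj mulmx_diag; apply/matrixP => i k.
by rewrite !mxE; congr (_ *+ _); case: ifP; rewrite ?mulrNN mulr1.
Qed.

Lemma refl_su3 j X : su3 X -> su3 (refl j *m X *m refl j).
Proof. by move=> /(su3_Ad (refl_SU3 j)); rewrite refl_adj. Qed.

Lemma reflE j X i l :
  (refl j *m X *m refl j) i l = if (i == j) == (l == j) then X i l else - X i l.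
Proof.
rewrite mul_mx_diag mul_diag_mx !mxE.
by case: (i == j); case: (l == j); rewrite ?mulN1r ?mulrN1 ?mul1r ?mulr1 ?opprK.
Qed.

(** The projections onto the eigenspaces of conjugation by [refl j], for the
eigenvalues 1 and -1. The scalars are real because su(3) is only a real
vector space. *)
Definition u2_part j X : M3 := (2^-1 : R)%:C%C *: (refl j *m X *m refl j) + (2^-1 : R)%:C%C *: X.

Definition orth_part j X : M3 := (- 2^-1 : R)%:C%C *: (refl j *m X *m refl j) + (2^-1 : R)%:C%C *: X.

Lemma u2_orth_part j X : u2_part j X + orth_part j X = X.
Proof.
rewrite /u2_part /orth_part addrACA -!scalerDl -!rmorphD /= subrr scale0r add0r.
by have -> : (2^-1 + 2^-1 : R) = 1 by [field]; rewrite scale1r.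
Qed.

Lemma su3_half X : su3 X -> su3 ((2^-1 : R)%:C%C *: X).
Proof.
move=> sX; have := su3_lin (2^-1 - 1) sX sX.
by rewrite rmorphB rmorph1 scalerBl scale1r addrNK.
Qed.

Lemma u2_part_u2 j X : su3 X -> u2 j (u2_part j X).
Proof.
move=> sX; split; first by apply: su3_lin; [exact: refl_su3|exact: su3_half].
move=> i /negPf ij; rewrite /u2_part.
by split; rewrite mxE [X in X + _]mxE [X in _ + X]mxE reflE ij eqxx /= mulrN addNr.
Qed.

Lemma u2_refl j X : u2 j X -> refl j *m X *m refl j = X.
Proof.
move=> [_ X0]; apply/matrixP => i l; rewrite reflE.
have [->|ij] := eqVneq i j; have [->|lj] := eqVneq l j; rewrite ?eqxx //=.
- by have [_ ->] := X0 _ lj; rewrite oppr0.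
- by have [-> _] := X0 _ ij; rewrite oppr0.
Qed.

Lemma refl_invol j X : refl j *m (refl j *m X *m refl j) *m refl j = X.
Proof.
have rr : refl j *m refl j = 1%:M by rewrite -{2}(refl_adj j) SU3_adjV //; exact: refl_SU3.
by rewrite !mulmxA rr mul1mx -mulmxA rr mulmx1.
Qed.

Lemma orth_part_refl j X :
  refl j *m orth_part j X *m refl j = - orth_part j X.
Proof.
rewrite /orth_part mulmxDr mulmxDl -!scalemxAr -!scalemxAl refl_invol.
by rewrite rmorphN /= !scaleNr opprD opprK addrC.
Qed.

Lemma orth_part_orth B j X : bi_invariant_metric B -> su3 X ->
  orth_u2 B j (orth_part j X).
Proof.
move=> bB sX; have sV : su3 (orth_part j X).
  by apply: su3_lin; [exact: refl_su3|exact: su3_half].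
split=> // Y uY; have [sY _] := uY.
have := bi_invariant_Ad bB (refl_SU3 j) sV sY.
rewrite refl_adj orth_part_refl u2_refl // riemannian_opp //; last by case: bB.
by move=> /eqP; rewrite eq_sym -subr_eq0 opprK -mulr2n mulrn_eq0 /= => /eqP.
Qed.

Lemma refl_diag_comm (d : 'rV[C]_3) j X :
  refl j *m (diag_mx d *m X *m (diag_mx d)^t*) *m refl j =
  diag_mx d *m (refl j *m X *m refl j) *m (diag_mx d)^t*.
Proof. by rewrite adj_diag_mx; exact: diag_sandwich_swap. Qed.

Lemma u2_part_Ad (d : 'rV[C]_3) j X :
  u2_part j (diag_mx d *m X *m (diag_mx d)^t*) =
  diag_mx d *m u2_part j X *m (diag_mx d)^t*.
Proof. by rewrite /u2_part refl_diag_comm; exact/esym/sandwichDZ. Qed.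

Lemma orth_part_Ad (d : 'rV[C]_3) j X :
  orth_part j (diag_mx d *m X *m (diag_mx d)^t*) =
  diag_mx d *m orth_part j X *m (diag_mx d)^t*.
Proof. by rewrite /orth_part refl_diag_comm; exact/esym/sandwichDZ. Qed.

(** Conjugation by a diagonal matrix commutes with conjugation by [refl j], hence
preserves both summands, on each of which the metric is a multiple of [B]. *)
Lemma scaled_diag_Ad B j (t : R) m (d : 'rV[C]_3) X Y :
  bi_invariant_metric B -> scaled_along_u2 B j t m -> SU3 (diag_mx d) ->
  su3 X -> su3 Y ->
  m 1%:M (diag_mx d *m X *m (diag_mx d)^t*) (diag_mx d *m Y *m (diag_mx d)^t*)
  = m 1%:M X Y.
Proof.
move=> bB mB dS sX sY.
have scaledE Z Z' : su3 Z -> su3 Z' -> m 1%:M Z Z' =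
    t * B 1%:M (u2_part j Z) (u2_part j Z') + B 1%:M (orth_part j Z) (orth_part j Z').
  move=> sZ sZ'; rewrite -(mB _ _ _ _ (u2_part_u2 j sZ) (u2_part_u2 j sZ')
    (orth_part_orth j bB sZ) (orth_part_orth j bB sZ')).
  by rewrite !u2_orth_part.
have su2 Z : su3 Z -> su3 (u2_part j Z) by move=> /(u2_part_u2 j)[].
have sorth Z : su3 Z -> su3 (orth_part j Z) by move=> /(orth_part_orth j bB)[].
rewrite !scaledE ?u2_part_Ad ?orth_part_Ad; try exact: su3_Ad; try by [].
by congr (_ * _ + _); apply: bi_invariant_Ad => //; (exact: su2) || (exact: sorth).
Qed.

(** Translate to the identity with the side on which [m] is invariant: one of the
two diagonal factors disappears and the other acts by conjugation. *)
Lemma eschenburg_diag_invariant m (d e : 'rV[C]_3) g X Y :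
  eschenburg_metric_SU3 m -> SU3 (diag_mx d) -> SU3 (diag_mx e) -> SU3 g ->
  tangent g X -> tangent g Y ->
  m (diag_mx d *m g *m diag_mx e) (diag_mx d *m X *m diag_mx e) (diag_mx d *m Y *m diag_mx e)
  = m g X Y.
Proof.
move=> [[ml|mr] [B [j [t [bB _ _ mB]]]]] dS eS gS tX tY.
- set e' := \row_i (e 0 i)^*.
  have eE : (diag_mx e : M3)^t* = diag_mx e' by exact: adj_diag_mx.
  have e'S : SU3 (diag_mx e') by rewrite -eE; exact: SU3_adj.
  have at1 k Z Z' : SU3 k -> tangent k Z -> tangent k Z' ->
      m k Z Z' = m 1%:M (k^t* *m Z) (k^t* *m Z').
    move=> kS /tangent1 tZ /tangent1 tZ'; rewrite -(ml _ _ _ _ kS SU3_1 tZ tZ').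
    by rewrite mulmx1 !mulmxA SU3_adjV // !mul1mx.
  have geS := SU3M gS eS.
  rewrite -!mulmxA (ml _ _ _ _ dS geS (tangent_mulr eS tX) (tangent_mulr eS tY)).
  rewrite (at1 _ _ _ geS (tangent_mulr eS tX) (tangent_mulr eS tY)) (at1 _ _ _ gS tX tY).
  rewrite -(scaled_diag_Ad bB mB e'S tX tY) -eE trmxCK.
  by rewrite !adjmx_mulr.
- have at1 k Z Z' : SU3 k -> tangent k Z -> tangent k Z' ->
      m k Z Z' = m 1%:M (Z *m k^t*) (Z' *m k^t*).
    move=> kS /(tangent_su3r kS)/tangent1 tZ /(tangent_su3r kS)/tangent1 tZ'.
    rewrite -(mr _ _ _ _ kS SU3_1 tZ tZ').
    by rewrite mul1mx -!mulmxA SU3_adjK // !mulmx1.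
  have dgS := SU3M dS gS.
  rewrite (mr _ _ _ _ eS dgS (tangent_mull dS tX) (tangent_mull dS tY)).
  rewrite (at1 _ _ _ dgS (tangent_mull dS tX) (tangent_mull dS tY)) (at1 _ _ _ gS tX tY).
  rewrite -(scaled_diag_Ad bB mB dS (tangent_su3r gS tX) (tangent_su3r gS tY)).
  by rewrite !mull_adjmx.
Qed.

Lemma vertical_tangent p q g : \sum_i p i = \sum_i q i -> SU3 g ->
  tangent g (vertical p q g).
Proof.
move=> pq gS; rewrite /tangent /vertical /=.
set P := diag_mx (\row_i (p i)%:~R); set Q := diag_mx (\row_i (q i)%:~R).
rewrite -scalemxAr mulmxBr (mulmxA _ g Q) SU3_adjK // mul1mx; split.
- have adjZ (c : C) (M : M3) : (c *: M)^t* = c^* *: M^t*.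
    by apply/matrixP => i j; rewrite !mxE rmorphM.
  have adjB (M N : M3) : (M - N)^t* = M^t* - N^t*.
    by apply/matrixP => i j; rewrite !mxE rmorphB.
  by rewrite adjZ adjB !adjmxM trmxCK !adj_int_diag conjCi scaleNr mulmxA.
- rewrite mxtraceZ linearB /= mxtrace_mulC -mulmxA SU3_adjV // mulmx1.
  rewrite !mxtrace_diag; under eq_bigr do rewrite mxE.
  under [X in _ - X]eq_bigr do rewrite mxE.
  by rewrite -!rmorph_sum pq subrr mulr0.
Qed.

Lemma vertical_diag p q (d e : 'rV[C]_3) g :
  vertical p q (diag_mx d *m g *m diag_mx e) =
  diag_mx d *m vertical p q g *m diag_mx e.
Proof. exact: diag_sandwich_comm. Qed.

Lemma horizontal_part_diag p q m (d e : 'rV[C]_3) g X :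
  \sum_i p i = \sum_i q i ->
  eschenburg_metric_SU3 m -> SU3 (diag_mx d) -> SU3 (diag_mx e) -> SU3 g ->
  tangent g X ->
  horizontal_part m p q (diag_mx d *m g *m diag_mx e) (diag_mx d *m X *m diag_mx e)
  = diag_mx d *m horizontal_part m p q g X *m diag_mx e.
Proof.
move=> pq em dS eS gS tX; rewrite /horizontal_part vertical_diag.
have tV := vertical_tangent pq gS.
rewrite !eschenburg_diag_invariant //.
exact: sandwichB.
Qed.

Lemma horizontal_part_tangent p q m g X : \sum_i p i = \sum_i q i -> SU3 g ->
  tangent g X -> tangent g (horizontal_part m p q g X).
Proof.
move=> pq gS tX; have tV := vertical_tangent pq gS.
rewrite /horizontal_part; set r := _ / _.
by rewrite addrC -scaleNr -rmorphN; apply: tangent_lin.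
Qed.

(** The diagonal matrices w^a and wbar^b need not have determinant 1. As their
determinants are inverse to each other, a scalar c can be moved from one to the
other so that both lie in SU(3). *)
Lemma eschenburg_isometric p q a b (mE : metric R) :
  \sum_i p i = \sum_i q i -> \sum_i a i = \sum_i b i ->
  eschenburg_metric p q mE -> isometric_action mE a b.
Proof.
move=> pq ab [m em ->] w g X Y w1 gS tX tY; rewrite /submersion_metric.
have unitary_diagpow z r : S1 z -> @diagpow R z r \is unitarymx.
  move=> z1; apply/unitarymxP; rewrite adj_diag_mx mulmx_diag.
  apply/matrixP => i j; rewrite !mxE; congr (_ *+ _).
  by rewrite -normCK (S1Xz _ z1) expr1n.
have det_diagpow z r : S1 z -> \det (@diagpow R z r) = z ^ (\sum_i r i).
  move=> /S1_neq0 z0; rewrite det_diag; under eq_bigr do rewrite mxE.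
  by rewrite (big_morph (fun u => z ^ u) (fun u v => expfzDr u v z0) (expr0z z)).
have [c [c1 c3 cS]] := unitary_scale_SU3 (unitary_diagpow _ a w1).
have w1' : S1 w^* by rewrite S1_conj //; exact: S1V.
have c'S : SU3 (c^-1 *: diagpow w^* b).
  split; first by apply: scale_unitarymx; [exact: S1V|exact: unitary_diagpow].
  rewrite detZ det_diagpow // S1_conj // exprz_inv -ab -invr_expz exprVn -invfM.
  by rewrite -(det_diagpow _ _ w1) c3 invr1.
have biq_diag M : biq a b w M = diag_mx (c *: \row_i w ^ a i) *m M *m
    diag_mx (c^-1 *: \row_i w^* ^ b i).
  exact/diag_sandwich_rescale/S1_neq0.
rewrite !biq_diag; rewrite -linearZ /= in cS; rewrite -linearZ /= in c'S.
rewrite (horizontal_part_diag pq em cS c'S gS tX) (horizontal_part_diag pq em cS c'S gS tY).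
exact: (eschenburg_diag_invariant em cS c'S gS
  (horizontal_part_tangent m pq gS tX) (horizontal_part_tangent m pq gS tY)).
Qed.

End Metric.

(** * The singular locus *)

Section Singular.
Variable R : realType.
Local Notation C := R[i].
Variables p q a b : 'I_3 -> int.
Local Notation D := (weight_det (weight p q) (weight a b)).

Lemma biq_support (z : C) (u v : 'I_3 -> int) (g : 'M[C]_3) i j : S1 z ->
  (biq u v z g i j != 0) = (g i j != 0).
Proof. by move=> z1; rewrite biqE // mxE mulf_eq0 expfz_eq0 (negPf (S1_neq0 z1)) andbF. Qed.

Lemma act_E1 (x : set 'M[C]_3) : act_E a b 1 x = x.
Proof.
apply/seteqP; split=> [_ [g xg <-]|g xg]; first by rewrite biq1.
by exists g => //; rewrite biq1.
Qed.

(** All points over a vertex have the same support, which determines the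
permutation. *)
Lemma vertex_parity (e : bool) (s : 'S_3) (g : 'M[C]_3) : T2 s g ->
  vertices R p q a b e (proj_O a b (proj_E p q g)) -> odd_perm s = e.
Proof.
move=> [_ gs] [t te [_ [g' [_ g't] <-]]] /seteqP[_ sub].
have [w w1] : proj_O a b (proj_E p q g') (proj_E p q g).
  by apply: sub; exists 1; [exact: S1_1|rewrite act_E1].
move=> eqE; have : proj_E p q g g by exact: proj_E_refl.
rewrite -eqE => -[_ [z z1 <-]] gE.
have st j : (j == s i1) = (j == t i1).
  by rewrite -gs -gE !biq_support.
have tE : odd_perm t = e by [].
rewrite -tE; congr odd_perm; apply/permP => i.
have : g i (t i) != 0 by rewrite -gE !biq_support // g't.
by rewrite gs => /eqP.
Qed.

Lemma nonsingular_of_singular_locus (e : bool) (s : 'S_3) (g : 'M[C]_3) :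
  singular_locus R p q a b `<=` vertices R p q a b e -> T2 s g ->
  odd_perm s != e -> isotropy a b (proj_E p q g) `<=` ineffective_kernel p q a b.
Proof.
move=> sing gs se; apply: contrapT => not_sub; case/eqP: se.
apply: (vertex_parity gs); apply: sing; exists (proj_E p q g) => //.
split; first by exists g => //; case: gs.
split=> // w [w1 triv]; split=> //.
by apply: triv; exists g => //; case: gs.
Qed.

(** A transversal of nonzero entries of the parity of [s] forces trivial
isotropy, so a singular point has none. *)
Lemma singular_locus_vertices (s : 'S_3) :
  (forall t, odd_perm t = odd_perm s -> D t = 1 \/ D t = -1) ->
  singular_locus R p q a b `<=` vertices R p q a b (~~ odd_perm s).
Proof.
move=> Dunit _ [x [[g gSU <-] [_ not_sub]] <-]; have [ug dg] := gSU.
have [t te gt] : exists2 t : 'S_3, odd_perm t = ~~ odd_perm s &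
    forall i j, (g i j != 0) = (j == t i).
  apply: one_parity_support => // t; rewrite negbK => ts.
  apply: contra_notP not_sub => /eqP/prodf_neq0 gt w gw.
  have w1 : w = 1.
    have wD : w ^ D t = 1 by apply: (isotropy_weight_det _ gw) => i; apply: gt.
    have [Dt|Dt] := Dunit t ts; first by rewrite -[w]expr1z -Dt.
    by apply: invr_inj; rewrite invr1 -[LHS]expr1z exprz_inv -Dt.
  by rewrite w1; split=> [|? _]; [exact: S1_1|exact: act_E1].
exists t => //; exists (proj_E p q g) => //.
by exists g.
Qed.

End Singular.

(** The weights of [a], [b] depend only on differences, so b at [s i3] may be
taken to be 0. Then x, y, z, w are the second weights at (2, s 3), (1, s 2),
(1, s 3), (2, s 1), and the third entry of [a] equalises the two sums. *)
Lemma action_of_solution (p q : 'I_3 -> int) (s : 'S_3) (x y z w : int) :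
  exists a b, \sum_i a i = \sum_i b i /\
  [/\ weight_det (weight p q) (weight a b) s = alpha_form p q s x y z w,
      weight_det (weight p q) (weight a b) (rot3 * s)%g =
        x * (p i1 - q (s i2)) - y * (p i2 - q (s i3))
    & weight_det (weight p q) (weight a b) (rot3 * (rot3 * s))%g =
        w * (p i1 - q (s i3)) - z * (p i2 - q (s i1))].
Proof.
pose a (i : 'I_3) : int := nth 0 [:: z; x; - w - y] (nat_of_ord i).
pose b (j : 'I_3) : int := nth 0 [:: x - w; z - y; 0] (nat_of_ord ((s^-1)%g j)).
have bs i : b (s i) = nth 0 [:: x - w; z - y; 0] (nat_of_ord i) by rewrite /b permK.
exists a, b; split.
  by rewrite !sum3 -(sum3_perm b s) !bs /a /=; ring.
rewrite /weight_det !rot3M /weight !bs /a /alpha_form /=.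
by split; ring.
Qed.

Theorem theoremB (R : realType) (p q : 'I_3 -> int) (mE : metric R)
    (hpq : \sum_i p i = \sum_i q i)
    (hfree : free_action R p q)
    (hmE : eschenburg_metric p q mE) :
  (exists a b : 'I_3 -> int,
     [/\ \sum_i a i = \sum_i b i,
         isometric_action mE a b,
         almost_free R p q a b
       & exists e : bool, singular_locus R p q a b `<=` vertices R p q a b e])
  <->
  (exists (s : 'S_3) (e1 e2 : int),
     [/\ e1 = 1 \/ e1 = -1, e2 = 1 \/ e2 = -1 & alpha p q s e1 e2 = 0]).
Proof.
have pq_coprime := free_coprime_weights hpq hfree.
split=> [[a [b [ab _ afree [e sing]]]]|[s [e1 [e2 [e1E e2E]]]]].
- have D0 := (almost_freeP R hpq ab pq_coprime).1 afree.
  have [s se] : exists s : 'S_3, odd_perm s != e.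
    case: e {sing}; first by exists 1%g; rewrite odd_perm1.
    by exists (tperm i1 i2); rewrite odd_tperm.
  exists s; apply: (alpha_eq0_of_full_lattice hpq pq_coprime) => t ts; split; first exact: D0.
  have [g gt] := T2_nonempty R t.
  apply: (nonsingular_vertex hpq ab pq_coprime gt (D0 t)).
  by apply: (nonsingular_of_singular_locus sing gt); rewrite ts.
- move=> /(alpha_eq0P s hpq pq_coprime)[x [y [z [w [xy wz form]]]]].
  have [a [b [ab [Ds Drs Drrs]]]] := action_of_solution p q s x y z w.
  rewrite form in Ds; rewrite xy in Drs; rewrite wz in Drrs.
  have Dunit t : odd_perm t = odd_perm s ->
      weight_det (weight p q) (weight a b) t = 1 \/ weight_det (weight p q) (weight a b) t = -1.
    by move/esym/perm3_coset => [] ->; rewrite ?Ds ?Drs ?Drrs //; right.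
  exists a, b; split=> //; first exact: eschenburg_isometric hpq ab hmE.
    apply/(almost_freeP R hpq ab pq_coprime) => t.
    have [/Dunit[] -> //|ts] := eqVneq (odd_perm t) (odd_perm s).
    exact: weight_det_opposite_neq0 Dunit t ts.
  exists (~~ odd_perm s); exact: singular_locus_vertices.
Qed.
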